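(* Suppose the data assumption stated in the context holds. Let $\mathbf{W}=(W_H,\dots,W_1)$ be a first-order critical point of $L$ associated with $\mathcal{S}$, let $r=|\mathcal{S}|=\operatorname{rk}(W_H\cdots W_1)$, and let $Q=\llbracket1,d_y\rrbracket\setminus\mathcal{S}$. Then there exist invertible matrices $D_{H-1}\in\mathbb{R}^{d_{H-1}\times d_{H-1}},\dots,D_1\in\mathbb{R}^{d_1\times d_1}$ and matrices $Z_H\in\mathbb{R}^{(d_y-r)\times(d_{H-1}-r)}$, $Z_1\in\mathbb{R}^{(d_1-r)\times d_x}$ and $Z_h\in\mathbb{R}^{(d_h-r)\times(d_{h-1}-r)}$ for $h\in\llbracket2,H-1\rrbracket$ such that, denoting $\widetilde W_H=W_HD_{H-1}$, $\widetilde W_1=D_1^{-1}W_1$ and $\widetilde W_h=D_h^{-1}W_hD_{h-1}$ for all $h\in\llbracket2,H-1\rrbracket$, we have $$\widetilde W_H=[U_{\mathcal{S}},\,U_QZ_H],\qquad \widetilde W_1=\begin{bmatrix}U_{\mathcal{S}}^T\Sigma_{YX}\Sigma_{XX}^{-1}\\ Z_1\end{bmatrix},\qquad \widetilde W_h=\begin{bmatrix}I_r&0\\0&Z_h\end{bmatrix}\ \ \forall h\in\llbracket2,H-1\rrbracket,$$ $$\widetilde W_H\cdots\widetilde W_2=[U_{\mathcal{S}},\,0].$$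
   Context: Setting. Let $H\ge 2$ and let $d_0,\dots,d_H,m$ be positive integers; write $d_x=d_0$, $d_y=d_H$. Parameters are $\mathbf{W}=(W_H,\dots,W_1)$ with $W_h\in\mathbb{R}^{d_h\times d_{h-1}}$. Given data $X\in\mathbb{R}^{d_x\times m}$, $Y\in\mathbb{R}^{d_y\times m}$, the loss is $L(\mathbf{W})=\|W_H\cdots W_1X-Y\|^2$ (Frobenius norm). Set $\Sigma_{XX}=XX^T$, $\Sigma_{XY}=XY^T$, $\Sigma_{YX}=YX^T$. Data assumption. $d_y\le d_x\le m$, $\Sigma_{XX}$ is invertible, $\Sigma_{XY}$ has full rank $d_y$, and, with $\Sigma^{1/2}=\Sigma_{YX}\Sigma_{XX}^{-1}X\in\mathbb{R}^{d_y\times m}$ and $\Sigma=\Sigma^{1/2}(\Sigma^{1/2})^T=\Sigma_{YX}\Sigma_{XX}^{-1}\Sigma_{XY}$, the singular values of $\Sigma^{1/2}$ are all distinct (i.e. $\Sigma$ has $d_y$ distinct eigenvalues). Let $\Sigma^{1/2}=U\Delta V^T$ be a singular value decomposition with $U\in\mathbb{R}^{d_y\times d_y}$, $V\in\mathbb{R}^{m\times m}$ orthogonal and the diagonal entries of $\Delta\in\mathbb{R}^{d_y\times m}$ in decreasing order. Notation. $\llbracket a,b\rrbracket$ is the set of integers from $a$ to $b$ (empty if $a>b$). $A_{\mathcal{J}}$ is the submatrix of $A$ formed by the columns indexed by $\mathcal{J}$. $[A,B]$ is horizontal concatenation. Blocks may have 0 rows or 0 columns (then they are absent); a product of a matrix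 with 0 columns and a matrix with 0 rows is the zero matrix of the appropriate size. A first-order critical point is a $\mathbf{W}$ with $\nabla L(\mathbf{W})=0$ (gradient with respect to all entries). For every first-order critical point $\mathbf{W}$, with $r=\operatorname{rk}(W_H\cdots W_1)$, there is a unique $\mathcal{S}\subset\llbracket 1,d_y\rrbracket$ of size $r$ such that $W_H\cdots W_1=U_{\mathcal{S}}U_{\mathcal{S}}^T\Sigma_{YX}\Sigma_{XX}^{-1}$; $\mathbf{W}$ is said to be associated with $\mathcal{S}$. *)

(* Defs.v *)
From HB Require Import structures.
From mathcomp Require Import all_boot all_order all_algebra.
From mathcomp Require Import all_classical all_reals all_analysis.

Set Implicit Arguments.
Unset Strict Implicit.
Unset Printing Implicit Defensive.

Import Order.TTheory GRing.Theory Num.Theory.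
Import numFieldNormedType.Exports.
Local Open Scope ring_scope.

Section Network.
Context {R : realType}.

(* Layer [h] is the matrix [W h], with [d h] rows and [d h.-1] columns.  For a
   network of depth [H] only the layers [1 <= h <= H] matter. *)
Definition params (d : nat -> nat) := forall h : nat, 'M[R]_(d h, d h.-1).

(* [layer_prod W l k] is W_k ... W_{l+1}, meaningful for [l <= k]; it is the
   empty product, [pid_mx (d l) = 1%:M], for [k = l]. *)
Fixpoint layer_prod (d : nat -> nat) (W : params d) (l k : nat) :
    'M[R]_(d k, d l) :=
  if k is k'.+1 return 'M[R]_(d k, d l) then
    if (k' < l)%N then pid_mx (d l) else W k'.+1 *m layer_prod W l k'
  else pid_mx (d l).

Lemma layer_prod_id d (W : params d) l : layer_prod W l l = 1%:M.
Proof. by case: l => [|l] /=; rewrite ?ltnSn pid_mx_1. Qed.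

Lemma layer_prodS d (W : params d) l k : (l <= k)%N ->
  layer_prod W l k.+1 = W k.+1 *m layer_prod W l k.
Proof. by move=> lk /=; rewrite ltnNge lk. Qed.

Lemma rank_layer_prod d (W : params d) (H h : nat) : (h <= H)%N ->
  (\rank (layer_prod W 0 H) <= d h)%N.
Proof.
elim: H => [|H IH]; first by rewrite leqn0 => /eqP ->; exact: rank_leq_row.
rewrite leq_eqVlt => /predU1P[->|hH]; first exact: rank_leq_row.
by rewrite layer_prodS //; apply: leq_trans (mxrankM_maxr _ _) (IH hH).
Qed.

Definition frob_sq (p q : nat) (A : 'M[R]_(p, q)) : R :=
  \sum_(i < p) \sum_(j < q) A i j ^+ 2.

Definition loss (d : nat -> nat) (H m : nat) (X : 'M[R]_(d 0%N, m))
    (Y : 'M[R]_(d H, m)) (W : params d) : R :=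
  frob_sq (layer_prod W 0 H *m X - Y).

(* All partial derivatives of the loss vanish: [t] is added to the entry
   [(i, j)] of layer [h], everything else being kept fixed. *)
Definition first_order_critical (d : nat -> nat) (H m : nat)
    (X : 'M[R]_(d 0%N, m)) (Y : 'M[R]_(d H, m)) (W : params d) : Prop :=
  forall (h : nat) (i : 'I_(d h)) (j : 'I_(d h.-1)), (1 <= h <= H)%N ->
    is_derive (0 : R) (1 : R)
      (fun t : R => loss X Y (eqtype.dfwith W (W h + t *: delta_mx i j)) : R) (0 : R).

Section Data.
Variables (dx dy m : nat) (X : 'M[R]_(dx, m)) (Y : 'M[R]_(dy, m)).

Definition SigmaXX : 'M[R]_dx := X *m X^T.
Definition SigmaXY : 'M[R]_(dx, dy) := X *m Y^T.
Definition SigmaYX : 'M[R]_(dy, dx) := Y *m X^T.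
Definition Sigma_half : 'M[R]_(dy, m) := SigmaYX *m invmx SigmaXX *m X.
Definition Sigma : 'M[R]_dy := Sigma_half *m Sigma_half^T.

(* The singular values of [Sigma_half] are the square roots of the [dy]
   eigenvalues of [Sigma]: they are distinct when [Sigma] has [dy] distinct
   eigenvalues. *)
Definition data_assumption : Prop :=
  [/\ (dy <= dx <= m)%N,
      SigmaXX \in unitmx,
      \rank SigmaXY = dy &
      exists s : dy.-tuple R, uniq s /\ {in s, forall a, eigenvalue Sigma a}].

End Data.

Definition is_svd (p q : nat) (A : 'M[R]_(p, q))
    (U : 'M[R]_p) (Delta : 'M[R]_(p, q)) (V : 'M[R]_q) : Prop :=
  [/\ U^T *m U = 1%:M, V^T *m V = 1%:M & A = U *m Delta *m V^T] /\
  [/\ forall (i : 'I_p) (j : 'I_q), i != j :> nat -> Delta i j = 0,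
      forall (i : 'I_p) (j : 'I_q), i = j :> nat -> 0 <= Delta i j &
      forall (i i' : 'I_p) (j j' : 'I_q), i = j :> nat -> i' = j' :> nat ->
        (i <= i')%N -> Delta i' j' <= Delta i j].

(* The submatrix of the columns of [A] indexed by [J], in increasing order. *)
Definition cols (p q : nat) (J : {set 'I_q}) (A : 'M[R]_(p, q)) :
    'M[R]_(p, #|J|) :=
  colsub (fun k : 'I_#|J| => enum_val k) A.

Definition associated (d : nat -> nat) (H m : nat) (X : 'M[R]_(d 0%N, m))
    (Y : 'M[R]_(d H, m)) (U : 'M[R]_(d H)) (W : params d)
    (S : {set 'I_(d H)}) : Prop :=
  #|S| = \rank (layer_prod W 0 H) /\
  layer_prod W 0 H =
    cols S U *m (cols S U)^T *m SigmaYX X Y *m invmx (SigmaXX X).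

(* Transport of a block matrix whose sizes have the form [r + (n - r)] to the
   sizes [n] expected by the context.  These agree as soon as [r <= n]; for a
   layer width and the rank [r] of the product of the layers this is
   [rank_layer_prod].  The default value 0 is for unequal sizes only. *)
Definition resize (p q p' q' : nat) (A : 'M[R]_(p, q)) : 'M[R]_(p', q') :=
  conform_mx 0 A.

End Network.

Arguments resize {R p q p' q'} A.

(* Main.v *)
Require Import Defs.
From HB Require Import structures.
From mathcomp Require Import all_boot all_order all_algebra.
From mathcomp Require Import all_classical all_reals all_analysis.
From mathcomp Require Import ring.

Set Implicit Arguments.
Unset Strict Implicit.
Unset Printing Implicit Defensive.

Import Order.TTheory GRing.Theory Num.Theory.
Import numFieldNormedType.Exports.
Local Open Scope ring_scope.

(** Write [A_h = W_H ... W_{h+1}], [K = A_1], [P = W_H ... W_1 = K W_1] and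
    [M = Sigma_YX Sigma_XX^-1], so that [P = U_S U_S^T M].

    The gradient with respect to the first layer is, up to a factor 2,
    [K^T (P Sigma_XX - Sigma_YX)] ([first_layer_gradient]).  Substituting [P],
    its vanishing reads [K^T (U_S U_S^T - 1) Sigma_YX = 0]; as [Sigma_YX] has
    full row rank, [K = U_S U_S^T K], that is, the range of [K] lies in that of
    [U_S].  Hence [r = rk P <= rk (U_S^T K)], so [U_S^T K] has a right inverse
    [G_1].

    The vectors of [G_1] are then carried through the network:
    [G_h = W_h ... W_2 G_1] and [C_h = U_S^T A_h] satisfy [C_h G_h = 1],
    [W_h G_{h-1} = G_h] and [C_h W_h = C_{h-1}].  So each hidden space is the
    direct sum of the range of [G_h], of dimension [r], and of the kernel of
    [C_h]; both families of subspaces are preserved by the layers, and [W_h]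
    acts as the identity between the chosen bases of the first summands.  Taking
    for [D_h] the basis [G_h] completed by a basis [N_h] of [ker C_h]
    ([adapted_basis]) makes the hidden layers block diagonal.  The first [r]
    rows of [D_h^-1] are [C_h], hence the top block of the first layer is
    [C_1 W_1 = U_S^T P = U_S^T M].  The last layer sends [G_{H-1}] to
    [K G_1 = U_S] and [ker C_{H-1}] into [ker U_S^T], the range of [U_Q].
    Finally [K D_1 = [K G_1, K N_1] = [U_S, U_S C_1 N_1] = [U_S, 0]]. *)

Lemma resize_id (R : realType) (p q : nat) (A : 'M[R]_(p, q)) : resize A = A.
Proof. exact: conform_mx_id. Qed.

(** Stating this for a variable [n] equal to [r + p], here and in the next three
    lemmas, lets the equation be eliminated, so that [resize] is the identity. *)
Lemma mul_resize_row_mx (R : realType) (k q r p n : nat) (C : 'M[R]_(k, q))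
    (A : 'M[R]_(q, r)) (B : 'M[R]_(q, p)) : (r + p = n)%N ->
  C *m (resize (row_mx A B) : 'M[R]_(q, n))
  = resize (row_mx (C *m A) (C *m B)).
Proof. by move=> <-; rewrite !resize_id mul_mx_row. Qed.

Lemma resize_col_mx_mul (R : realType) (k q r p n : nat) (C : 'M[R]_(q, k))
    (A : 'M[R]_(r, q)) (B : 'M[R]_(p, q)) : (r + p = n)%N ->
  (resize (col_mx A B) : 'M[R]_(n, q)) *m C
  = resize (col_mx (A *m C) (B *m C)).
Proof. by move=> <-; rewrite !resize_id mul_col_mx. Qed.

Lemma resize_col_mx_row_mx (R : realType) (q r p p' n n' : nat)
    (A : 'M[R]_(r, q)) (B : 'M[R]_(p, q))
    (A' : 'M[R]_(q, r)) (B' : 'M[R]_(q, p')) :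
  (r + p = n)%N -> (r + p' = n')%N ->
  (resize (col_mx A B) : 'M[R]_(n, q)) *m (resize (row_mx A' B') : 'M[R]_(q, n'))
  = resize (block_mx (A *m A') (A *m B') (B *m A') (B *m B')).
Proof. by move=> <- <-; rewrite !resize_id mul_col_row. Qed.

Lemma resize_block1 (R : realType) (r p n : nat) : (r + p = n)%N ->
  resize (block_mx 1%:M 0 0 1%:M : 'M[R]_(r + p)) = 1%:M :> 'M[R]_n.
Proof. by move=> <-; rewrite resize_id -scalar_mx_block. Qed.

Lemma layer_prod_succ (R : realType) (d : nat -> nat) (W : params d) (l : nat) :
  layer_prod W l l.+1 = W l.+1 :> 'M[R]_(_, _).
Proof. by rewrite layer_prodS // layer_prod_id mulmx1. Qed.

Lemma layer_prod_cat (R : realType) (d : nat -> nat) (W : params d)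
    (l j k : nat) : (l <= j <= k)%N ->
  layer_prod W l k = layer_prod W j k *m layer_prod W l j :> 'M[R]_(_, _).
Proof.
case/andP=> lj; elim: k => [|k IH].
  by rewrite leqn0 => /eqP jk; subst j; rewrite layer_prod_id mul1mx.
rewrite leq_eqVlt => /predU1P[->|jk]; first by rewrite layer_prod_id mul1mx.
by rewrite !layer_prodS ?(leq_trans lj) // IH // mulmxA.
Qed.

Lemma layer_prod_recr (R : realType) (d : nat -> nat) (W : params d)
    (h k : nat) : (h < k)%N ->
  layer_prod W h k = layer_prod W h.+1 k *m W h.+1 :> 'M[R]_(_, _).
Proof. by move=> hk; rewrite (@layer_prod_cat _ _ _ h h.+1) ?leqnSn //
  layer_prod_succ. Qed.

Lemma eq_layer_prod (R : realType) (d : nat -> nat) (W W' : @params R d)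
    (l k : nat) : (forall h, (l < h)%N -> W h = W' h) ->
  layer_prod W l k = layer_prod W' l k.
Proof.
move=> eqW; elim: k => [//|k IH] /=.
by case: ltnP => // lk; rewrite IH eqW.
Qed.

(** The inner factors [D h *m invmx (D h)] telescope.  Taking [D] invertible at
    every index, the ends included, gives one formula for all layers. *)
Lemma layer_prod_change_basis (R : realType) (d : nat -> nat) (W : @params R d)
    (D : forall h, 'M[R]_(d h)) (l k : nat) :
  (forall h, D h \in unitmx) -> (l <= k)%N ->
  layer_prod (fun h => invmx (D h) *m W h *m D h.-1 : 'M[R]_(d h, d h.-1)) l k
  = invmx (D k) *m layer_prod W l k *m D l.
Proof.
move=> uD; elim: k => [|k IH].
  by rewrite leqn0 => /eqP ->; rewrite !layer_prod_id mulmx1 mulVmx.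
rewrite leq_eqVlt => /predU1P[->|lk].
  by rewrite !layer_prod_id mulmx1 mulVmx.
by rewrite !layer_prodS // IH //= !mulmxA mulmxK.
Qed.

(** The loss is a quadratic polynomial along each coordinate line of a layer, so
    only its linear coefficient matters at [0]. *)
Lemma is_derive_quadratic (R : realType) (a b c : R) :
  is_derive (0 : R) (1 : R) (fun t : R => a + t * b + t ^+ 2 * c : R) b.
Proof.
have Dt : is_derive (0 : R) (1 : R) (id : R -> R) 1 := is_derive_id _ _.
have Da := is_derive_cst (a : R) (0 : R) (1 : R).
have Db := is_derive_cst (b : R) (0 : R) (1 : R).
have Dc := is_derive_cst (c : R) (0 : R) (1 : R).
apply: (is_derive_eq (is_deriveD (is_deriveD Da (is_deriveM Dt Db))
  (is_deriveM (is_deriveX 2 Dt) Dc))).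
by rewrite /GRing.scale /=; ring.
Qed.

Lemma frob_sqD (R : realType) (p q : nat) (E F : 'M[R]_(p, q)) (t : R) :
  frob_sq (E + t *: F)
  = frob_sq E + t * (2 * \tr (E^T *m F)) + t ^+ 2 * frob_sq F.
Proof.
have -> : \tr (E^T *m F) = \sum_i \sum_j E i j * F i j.
  rewrite /mxtrace exchange_big; apply: eq_bigr => j _.
  by rewrite mxE; apply: eq_bigr => i _; rewrite mxE.
rewrite /frob_sq !mulr_sumr -!big_split; apply: eq_bigr => i _ /=.
rewrite !mulr_sumr -!big_split; apply: eq_bigr => j _ /=.
by rewrite !mxE; ring.
Qed.

Lemma mxtrace_mul_delta (K : comNzRingType) (p q : nat) (A : 'M[K]_(q, p))
    (i : 'I_p) (j : 'I_q) : \tr (A *m delta_mx i j) = A j i.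
Proof.
rewrite -(mul_delta_mx (0 : 'I_1)) mulmxA mxtrace_mulC /mxtrace big_ord1.
by rewrite -rowE -colE !mxE.
Qed.

(** [C *m G = 1%:M] splits the space into the range of [G] and the kernel of
    [C].  The columns of [N] are a basis of that kernel and [T] reads the coordinates
    on it: [row_mx G N] and [col_mx C T] are inverse to each other.  For [T] one
    takes a basis of the row vectors that annihilate [G]. *)
Lemma adapted_basis (F : fieldType) (r p n : nat)
    (C : 'M[F]_(r, n)) (G : 'M[F]_(n, r)) : (r + p = n)%N -> C *m G = 1%:M ->
  exists (N : 'M[F]_(n, p)) (T : 'M[F]_(p, n)),
    [/\ C *m N = 0, T *m G = 0 & T *m N = 1%:M].
Proof.
move=> rpn CG; subst n.
have rkG : \rank G = r.
  apply/eqP; rewrite eqn_leq rank_leq_col /=.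
  by rewrite -[X in (X <= _)%N](mxrank1 F) -CG mxrankM_maxr.
have rk : \rank (kermx G) = p by rewrite mxrank_ker rkG addKn.
have [T TG freeT] : exists2 T : 'M[F]_(p, r + p), T *m G = 0 & row_free T.
  have: exists2 T : 'M[F]_(\rank (kermx G), r + p), T *m G = 0 & row_free T.
    exists (row_base (kermx G)); last exact: row_base_free.
    by apply/sub_kermxP; rewrite eq_row_base.
  by rewrite rk.
have uCT : col_mx C T \in unitmx.
  rewrite -row_free_unit -kermx_eq0; apply/eqP/row_matrixP => i.
  set v := row i _; have : v *m col_mx C T = 0.
    by rewrite /v -row_mul mulmx_ker row0.
  rewrite row0 -[v]hsubmxK mul_row_col => vCT.
  have vl : lsubmx v = 0.
    move/(congr1 (mulmx^~ G)): vCT.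
    by rewrite mulmxDl -!mulmxA CG TG mulmx1 mulmx0 addr0 mul0mx.
  move: vCT; rewrite vl mul0mx add0r => /(congr1 (mulmx^~ (pinvmx T))).
  by rewrite -mulmxA mulmxVp // mulmx1 mul0mx => ->; rewrite row_mx0.
exists (rsubmx (invmx (col_mx C T))), T.
have := mulmxV uCT.
rewrite -[X in _ *m X]hsubmxK mul_col_row scalar_mx_block.
by case/eq_block_mx => _ CN _ TN; split.
Qed.

Lemma cols_tr_mul (R : realType) (n : nat) (U : 'M[R]_n) (S : {set 'I_n}) :
  U^T *m U = 1%:M -> (cols S U)^T *m cols S U = 1%:M.
Proof.
move=> UU; apply/matrixP => i j; rewrite !mxE.
have := congr1 (fun M : 'M[R]_n => M (enum_val i) (enum_val j)) UU.
rewrite /= !mxE (inj_eq enum_val_inj) => <-.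
by apply: eq_bigr => k _; rewrite !mxE.
Qed.

(** The resolution of the identity into the orthogonal projections on the spans
    of two complementary sets of columns of [U]. *)
Lemma cols_mul_tr_setC (R : realType) (n : nat) (U : 'M[R]_n) (S : {set 'I_n}) :
  U^T *m U = 1%:M ->
  cols S U *m (cols S U)^T + cols (~: S) U *m (cols (~: S) U)^T = 1%:M.
Proof.
move=> /mulmx1C <-; apply/matrixP => i j; rewrite !mxE.
have E (J : {set 'I_n}) : \sum_k cols J U i k * (cols J U)^T k j
    = \sum_(k in J) U i k * U^T k j.
  by rewrite [RHS]big_enum_val; apply: eq_bigr => k _; rewrite !mxE.
rewrite !E [RHS](bigID (mem S)) /=; congr (_ + _).
by apply: eq_bigl => k; rewrite !inE.
Qed.

(** Twice the left-hand side is the gradient of the loss in the first layer.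
    With [K] the product of the other layers and [E] the residual, the derivative
    in the direction [delta_mx i j] is [2 \tr (E^T K (delta_mx i j) X)], twice
    the entry [(i, j)] of [K^T E X^T]. *)
Lemma first_layer_gradient (R : realType) (H : nat) (d : nat -> nat) (m : nat)
    (X : 'M[R]_(d 0%N, m)) (Y : 'M[R]_(d H, m)) (W : params d) :
  (1 <= H)%N -> first_order_critical X Y W ->
  (layer_prod W 1 H)^T *m (layer_prod W 0 H *m SigmaXX X - SigmaYX X Y) = 0.
Proof.
move=> H1 crit; set K := layer_prod W 1 H.
pose E := layer_prod W 0 H *m X - Y.
suff EK : K^T *m E *m X^T = 0.
  by rewrite -[RHS]EK /E /SigmaXX /SigmaYX -mulmxA mulmxBl !mulmxA.
apply/matrixP => i j; rewrite [RHS]mxE.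
have lossE t : loss X Y (eqtype.dfwith W (W 1%N + t *: delta_mx i j))
    = frob_sq (E + t *: (K *m delta_mx i j *m X)).
  rewrite /loss /E ![layer_prod _ 0 _]layer_prod_recr // eqtype.dfwith_in.
  rewrite (@eq_layer_prod _ _ (eqtype.dfwith _ _) W).
    rewrite -/K mulmxDr mulmxDl -scalemxAr -scalemxAl.
    by rewrite addrAC.
  by move=> h h1; rewrite eqtype.dfwith_out // neq_ltn h1.
have -> : (K^T *m E *m X^T) i j = \tr (E^T *m (K *m delta_mx i j *m X)).
  rewrite mulmxA mxtrace_mulC !mulmxA mxtrace_mul_delta.
  have -> : K^T *m E *m X^T = (X *m E^T *m K)^T.
    by rewrite !trmx_mul trmxK mulmxA.
  by rewrite mxE.
have := crit 1%N i j H1; under eq_fun do rewrite lossE frob_sqD.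
case=> _; rewrite (@derive_val _ _ _ _ _ _ _ (is_derive_quadratic _ _ _)).
by move/eqP; rewrite mulf_eq0 pnatr_eq0 => /eqP.
Qed.

Theorem proposition9 (R : realType) (H : nat) (d : nat -> nat) (m : nat)
    (hH : (2 <= H)%N) (hd : forall h : nat, (h <= H)%N -> (0 < d h)%N)
    (hm : (0 < m)%N)
    (X : 'M[R]_(d 0%N, m)) (Y : 'M[R]_(d H, m)) (hdata : data_assumption X Y)
    (U : 'M[R]_(d H)) (Delta : 'M[R]_(d H, m)) (V : 'M[R]_m)
    (hsvd : is_svd (Sigma_half X Y) U Delta V)
    (W : params d) (hW : first_order_critical X Y W)
    (S : {set 'I_(d H)}) (hS : associated X Y U W S) :
  let r := #|S| in
  let Q := ~: S in
  exists (D : forall h : nat, 'M[R]_(d h))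
         (ZH : 'M[R]_(#|Q|, d H.-1 - r))
         (Z1 : 'M[R]_(d 1%N - r, d 0%N))
         (Z : forall h : nat, 'M[R]_(d h - r, d h.-1 - r))
         (Wt : params d),
    (forall h : nat, (1 <= h <= H.-1)%N -> D h \in unitmx) /\
    [/\ Wt H = W H *m D H.-1,
        Wt 1%N = invmx (D 1%N) *m W 1%N &
        forall h : nat, (2 <= h <= H.-1)%N ->
          Wt h = invmx (D h) *m W h *m D h.-1] /\
    [/\ Wt H = resize (row_mx (cols S U) (cols Q U *m ZH)),
        Wt 1%N = resize (col_mx ((cols S U)^T *m SigmaYX X Y
                                 *m invmx (SigmaXX X)) Z1),
        forall h : nat, (2 <= h <= H.-1)%N ->
          Wt h = resize (block_mx (1%:M : 'M[R]_r) 0 0 (Z h)) &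
        layer_prod Wt 1 H =
          resize (row_mx (cols S U) (0 : 'M[R]_(d H, d 1%N - r)))].
Proof.
move=> r Q.
have [rkS PE] := hS; have [[UU _ _] _] := hsvd.
have [_ uXX rkXY _] := hdata.
set US := cols S U in PE *; set UQ := cols Q U.
have USS : US^T *m US = 1%:M by exact: cols_tr_mul.
have USQ : US *m US^T + UQ *m UQ^T = 1%:M by exact: cols_mul_tr_setC.
set K := layer_prod W 1 H.
have H1 : (1 <= H)%N by exact: ltnW.
have PK : layer_prod W 0 H = K *m W 1%N by rewrite layer_prod_recr.
(* Criticality in the first layer puts the range of [K] inside that of [US]. *)
have KE : K = US *m (US^T *m K).
  have freeYX : row_free (SigmaYX X Y).
    rewrite /row_free -[SigmaYX X Y]trmxK mxrank_tr trmx_mul trmxK.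
    exact/eqP.
  have grad := first_layer_gradient H1 hW; rewrite -/K PE mulmxKV // in grad.
  have : K^T *m (US *m US^T - 1%:M) = 0.
    apply: (row_free_inj freeYX).
    by rewrite mul0mx -mulmxA mulmxBl mul1mx.
  move=> /(congr1 trmx); rewrite trmx_mul trmxK trmx0 linearB /= trmx_mul trmxK.
  by rewrite trmx1 mulmxBl mul1mx -mulmxA => /subr0_eq.
(* [P = US (US^T K) W_1] has rank [r], so the [r] rows of [US^T K] are free. *)
have [G1 KG1] : exists G1 : 'M[R]_(d 1%N, r), US^T *m K *m G1 = 1%:M.
  apply/row_freeP; rewrite -row_leq_rank [X in (X <= _)%N]rkS PK.
  by rewrite [in X in (X <= _)%N]KE -!mulmxA
    (leq_trans (mxrankM_maxr _ _)) // mulmxA mxrankM_maxl.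
pose C h := US^T *m layer_prod W h H.
pose G h := layer_prod W 1 h *m G1.
have CS h : (0 < h <= H)%N -> C h *m W h = C h.-1.
  by case: h => // h /andP[_ hH']; rewrite /C -mulmxA -layer_prod_recr.
have GS h : (1 < h)%N -> W h *m G h.-1 = G h.
  by case: h => // h h1; rewrite /G layer_prodS // mulmxA.
have CG h : (1 <= h <= H)%N -> C h *m G h = 1%:M.
  by move=> hh; rewrite /C /G mulmxA -(mulmxA US^T) -layer_prod_cat.
have rd h : (h <= H)%N -> (r + (d h - r) = d h)%N.
  by move=> hh; rewrite subnKC // /r rkS; exact: rank_layer_prod.
pose hid h := (1 <= h <= H.-1)%N.
have hidH h : hid h -> (1 <= h <= H)%N.
  by case/andP=> -> hh; exact: leq_trans hh (leq_pred _).
have basis h : exists NT : 'M[R]_(d h, d h - r) * 'M[R]_(d h - r, d h),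
    hid h -> [/\ C h *m NT.1 = 0, NT.2 *m G h = 0 & NT.2 *m NT.1 = 1%:M].
  case hh : (hid h); last by exists (0, 0).
  have /andP[h1 hH'] := hidH _ hh.
  have CGh := CG h (hidH _ hh).
  by have [N [T NT]] := adapted_basis (rd _ hH') CGh; exists (N, T).
pose N h := (sval (cid (basis h))).1; pose T h := (sval (cid (basis h))).2.
have NT h : hid h -> [/\ C h *m N h = 0, T h *m G h = 0 & T h *m N h = 1%:M].
  by rewrite /N /T; case: cid.
(* The identity at both ends makes [Wt] below a uniform change of basis. *)
pose D h : 'M[R]_(d h) :=
  if hid h then resize (row_mx (G h) (N h)) else 1%:M.
pose Di h : 'M[R]_(d h) := resize (col_mx (C h) (T h)).
have DiD h : hid h -> Di h *m D h = 1%:M.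
  move=> hh; have /andP[_ hH'] := hidH _ hh; have [CN TG TN] := NT h hh.
  rewrite /Di /D hh resize_col_mx_row_mx ?rd // CG ?hidH // CN TG TN.
  by rewrite resize_block1 ?rd.
have uD h : D h \in unitmx.
  case hh : (hid h); last by rewrite /D hh unitmx1.
  by have [] := mulmx1_unit (DiD h hh).
have invD h : hid h -> invmx (D h) = Di h.
  by move=> hh; rewrite -[LHS]mul1mx -(DiD h hh) mulmxK.
pose Wt h : 'M[R]_(d h, d h.-1) := invmx (D h) *m W h *m D h.-1.
have DH : D H = 1%:M.
  by rewrite /D /hid [X in X && _]H1 /= leqNgt ltn_predL H1.
have D0 : D 0%N = 1%:M by [].
have hid1 : hid 1%N by rewrite /hid /= -ltnS prednK.
have hidP : hid H.-1 by rewrite /hid leqnn andbT -ltnS prednK.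
have KG : K *m G1 = US by rewrite KE -mulmxA KG1 mulmx1.
exists D, (UQ^T *m W H *m N H.-1), (T 1%N *m W 1%N),
  (fun h => T h *m W h *m N h.-1), Wt.
have WtH : Wt H = W H *m D H.-1 by rewrite /Wt DH invmx1 mul1mx.
have Wt1 : Wt 1%N = invmx (D 1%N) *m W 1%N by rewrite /Wt D0 mulmx1.
split=> [h _ //|]; split; first by split.
split.
- rewrite WtH /D hidP mul_resize_row_mx ?rd ?leq_pred //.
  have [CN _ _] := NT _ hidP.
  congr (resize (row_mx _ _)).
    by rewrite GS.
  (* [W H *m N H.-1] has its columns in the kernel of [US^T], on which
     [UQ *m UQ^T] is the identity. *)
  have USWN : US^T *m (W H *m N H.-1) = 0.
    have <- : C H = US^T by rewrite /C layer_prod_id mulmx1.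
    by rewrite mulmxA CS ?H1 /=.
  rewrite -[LHS]mul1mx -USQ mulmxDl -[X in X + _]mulmxA USWN mulmx0 add0r.
  by rewrite !mulmxA.
- rewrite Wt1 invD // resize_col_mx_mul ?rd // CS //=.
  by rewrite /C PE !mulmxA USS mul1mx.
- move=> h /andP[h2 hh]; rewrite /Wt.
  have hidS : hid h by rewrite /hid ltnW.
  have hidh : hid h.-1 by rewrite /hid -ltnS (ltn_predK h2) h2
    (leq_trans (leq_pred _)).
  have [/andP[h0 hH1] /andP[_ hH2]] := (hidH _ hidS, hidH _ hidh).
  have [CN TG TN] := NT _ hidS; have [CN' _ _] := NT _ hidh.
  rewrite invD // /Di /D hidh resize_col_mx_mul ?rd //.
  rewrite resize_col_mx_row_mx ?rd // CS ?h0 // CG ?hidH // CN'.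
  (* The lower left block is [T h *m G h], since [W h] maps [G h.-1] to [G h]. *)
  by rewrite -!mulmxA GS // TG.
- rewrite layer_prod_change_basis // DH invmx1 mul1mx.
  have [CN _ _] := NT _ hid1.
  rewrite -/K /D hid1 mul_resize_row_mx ?rd //.
  congr (resize (row_mx _ _)).
    by rewrite /G layer_prod_id mul1mx.
  by rewrite KE -mulmxA CN mulmx0.
Qed.
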